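(* Let $I$ be a monomial ideal in $R=K[x_1,\ldots,x_n]$. Then $L_{\prec}(I)=ps(I,\prec)$ for each total order $\prec$ on $G(I)$. Furthermore, $L(I)=ps(I)$.
   Context: $K$ is a field and $G(I)$ denotes the minimal set of monomial generators of $I$. For a total order $\prec$ on $G(I)$ write $G(I)=\{m_1\prec\cdots\prec m_\mu\}$. For $A\subseteq G(I)$, $\mathrm{lcm}(A)$ is the least common multiple of the elements of $A$ and $\min(A)$ its least element under $\prec$. A symbol is $u(i_1;\ldots;i_t)$ with $1\le i_1<\cdots<i_t\le\mu$; it is $L$-admissible (of dimension $t$) if for all $h<t$ and all $q<i_h$, $m_q$ does not divide $\mathrm{lcm}(m_{i_h},\ldots,m_{i_t})$. The Lyubeznik resolution of $R/I$ with respect to $\prec$ has $L^0=R$, $L^t$ the free $R$-module on the $L$-admissible symbols of dimension $t$, and $$\partial_t(u(i_1;\ldots;i_t))=\sum_{j=1}^t(-1)^{j+1}\frac{\mathrm{lcm}(m_{i_1},\ldots,m_{i_t})}{\mathrm{lcm}(m_{i_1},\ldots,\widehat{m_{i_j}},\ldots,m_{i_t})}\,u(i_1;\ldots;\widehat{i_j};\ldots;i_t).$$ $L_{\prec}(I)$ (also written $L(I,\prec)$) is the length of this resolution, i.e. the largest $t$ with $L^t\neq0$, and $L(I)=\min\{L_{\prec}(I):\prec\text{ a total order on }G(I)\}$. A (nonempty) subset $D\subseteq G(I)$ is broken under $\prec$ if there is $u\in G(I)$ with $u\mid\mathrm{lcm}(D)$ and $u\prec\min(D)$. A subset $E\subseteq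 G(I)$ is preserved under $\prec$ if no subset of $E$ is broken. The preserved sizes are $ps(I,\prec)=\max\{|A|: A\subseteq G(I),\ A\text{ is preserved under }\prec\}$ and $ps(I)=\min\{ps(I,\prec):\prec\text{ is a total order on }G(I)\}$. *)

(* Defs.v *)
From HB Require Import structures.
From mathcomp Require Import all_boot all_order all_algebra finmap.
From mathcomp Require Import boolp classical_sets.
From mathcomp Require Import mpoly.
From mathcomp Require Import zify.

Set Implicit Arguments.
Unset Strict Implicit.
Unset Printing Implicit Defensive.

Import GRing.Theory.
Local Open Scope ring_scope.

(* For sets of natural numbers without greatest (resp. least) element the
   value is the junk 0; see greatestP and leastP. *)
Definition greatest (A : set nat) : nat :=
  xget 0%N [set k | A k /\ forall j, A j -> (j <= k)%N]%classic.

Definition least (A : set nat) : nat :=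
  xget 0%N [set k | A k /\ forall j, A j -> (k <= j)%N]%classic.

Lemma leastP (A : set nat) : (exists k, A k) ->
  A (least A) /\ forall j, A j -> (least A <= j)%N.
Proof.
move=> exA; apply: (@xgetPex _ 0%N
  [set k | A k /\ forall j, A j -> (k <= j)%N]%classic).
have exA' : exists k, `[< A k >] by case: exA => k Ak; exists k; apply/asboolP.
case: (ex_minnP exA') => k /asboolP Ak kmin; exists k; split=> // j Aj.
by apply: kmin; apply/asboolP.
Qed.

Lemma greatestP (A : set nat) (b : nat) :
    (exists k, A k) -> (forall k, A k -> (k <= b)%N) ->
  A (greatest A) /\ forall j, A j -> (j <= greatest A)%N.
Proof.
move=> exA ubA; apply: (@xgetPex _ 0%N
  [set k | A k /\ forall j, A j -> (j <= k)%N]%classic).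
have exA' : exists k, `[< A k >] by case: exA => k Ak; exists k; apply/asboolP.
have ubA' k : `[< A k >] -> (k <= b)%N by move/asboolP/ubA.
case: (ex_maxnP exA' ubA') => k /asboolP Ak kmax; exists k; split=> // j Aj.
by apply: kmax; apply/asboolP.
Qed.

Section MonomialIdeals.
Context {K : fieldType} {n : nat}.
Implicit Types (I : set {mpoly K[n]}) (G : {fset 'X_{1..n}}).

Definition monomial_span (S : set 'X_{1..n}) : set {mpoly K[n]} :=
  [set p | exists (k : nat) (c : 'I_k -> {mpoly K[n]}) (m : 'I_k -> 'X_{1..n}),
     (forall i, S (m i)) /\ p = \sum_(i < k) c i * 'X_[m i]]%classic.

Definition monomial_ideal I : Prop := exists S, I = monomial_span S.

Definition is_mingens I G : Prop :=
  I = monomial_span [set` G]%classic /\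
  forall G', (G' `<=` G)%fset -> I = monomial_span [set` G']%classic -> G' = G.

(* The set G(I); mingensP and mingens_uniq show that it is well defined. *)
Definition mingens I : {fset 'X_{1..n}} := xget fset0 (is_mingens I).

Lemma monomial_spanX (S : set 'X_{1..n}) (m : 'X_{1..n}) :
  monomial_span S 'X_[m] <-> exists2 m', S m' & (m' <= m)%MM.
Proof.
split=> [[k [c [s [Ss eqX]]]]|[m' Sm' le_m'm]]; last first.
  exists 1%N, (fun=> 'X_[m - m']), (fun=> m'); split=> //.
  by rewrite big_ord1 -mpolyXD submK.
have := congr1 (mcoeff m) eqX; rewrite mcoeffX eqxx raddf_sum /=.
have [/existsP[i le_sim] _|] := boolP [exists i, (s i <= m)%MM].
  by exists (s i).
rewrite negb_exists => /forallP nle /eqP.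
rewrite big1 ?oner_eq0 // => i _; apply/eqP; rewrite -[_ == 0]negbK -mcoeff_msupp.
apply: contra (nle i); rewrite (perm_mem (msuppMX _ _)) => /mapP[m1 _ ->].
by rewrite lem_addr.
Qed.

Lemma monomial_spanS (S T : set 'X_{1..n}) :
    (forall m, S m -> exists2 m', T m' & (m' <= m)%MM) ->
  forall p, monomial_span S p -> monomial_span T p.
Proof.
move=> ST p [k [c [s [Ss ->]]]].
have /choice[f fP] : forall i, exists m', T m' /\ (m' <= s i)%MM.
  by move=> i; have [m' ? ?] := ST _ (Ss i); exists m'.
exists k, (fun i => c i * 'X_[s i - f i]), f; split=> [i|]; first by case: (fP i).
by apply: eq_bigr => i _; rewrite -mulrA -mpolyXD submK //; case: (fP i).
Qed.

(* Dickson's lemma, by induction on the number of coordinates compared. *)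
Lemma dickson (k : nat) (S : set 'X_{1..n}) : exists s : seq 'X_{1..n},
  (forall m, m \in s -> S m) /\
  forall m, S m -> exists2 m', m' \in s & forall i : 'I_n, (i < k)%N -> (m' i <= m i)%N.
Proof.
elim: k S => [|k IHk] S.
  have [[m Sm]|noS] := pselect (exists m, S m).
    by exists [:: m]; split=> [_ /[!inE]/eqP->|m1 _] //; exists m => //; rewrite inE.
  by exists [::]; split=> // m Sm; case: noS; exists m.
have [s [sS sP]] := IHk S.
have [lt_kn|le_nk] := ltnP k n; last first.
  exists s; split=> // m /sP[m' m's le_m']; exists m' => // i _.
  by apply: le_m'; apply: leq_trans le_nk.
pose o := Ordinal lt_kn; pose N := (\max_(m <- s) m o)%N.
have /choice[f fP] := fun j : nat => IHk [set m | S m /\ m o = j]%classic.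
exists (s ++ flatten [seq f j | j <- iota 0 N]); split=> [m|m Sm].
  by rewrite mem_cat => /orP[/sS //|/flatten_mapP[j _ /(proj1 (fP j))[]]].
have [le_Nm|lt_mN] := leqP N (m o).
  have [m' m's le_m'] := sP m Sm; exists m'; first by rewrite mem_cat m's.
  move=> i; rewrite ltnS leq_eqVlt => /predU1P[eq_ik|/le_m' //].
  have ->: i = o by apply: val_inj.
  apply: leq_trans le_Nm; rewrite /N.
  exact: (@leq_bigmax_seq _ s xpredT (fun m1 : 'X_{1..n} => m1 o) m' m's erefl).
have [m' m'f le_m'] := proj2 (fP (m o)) m (conj Sm erefl).
exists m'.
  rewrite mem_cat; apply/orP; right; apply/flatten_mapP; exists (m o) => //.
  by rewrite mem_iota.
move=> i; rewrite ltnS leq_eqVlt => /predU1P[eq_ik|/le_m' //].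
have ->: i = o by apply: val_inj.
by case: (proj1 (fP (m o)) m' m'f) => _ ->.
Qed.

Lemma is_mingens_ex I : monomial_ideal I -> exists G, is_mingens I G.
Proof.
move=> [S ->]; have [s [sS sP]] := dickson n S.
have eqS : monomial_span S = monomial_span [set` seq_fset tt s]%classic.
  apply/seteqP; split; apply: monomial_spanS => m /=.
    move=> /sP[m' m's le_m']; exists m'; first by move: m's; rewrite -(seq_fsetE tt).
    by apply/mnm_lepP => i; apply: le_m'.
  move=> /= mS; exists m; last exact: lepm_refl.
  by apply: sS; rewrite -(seq_fsetE tt).
pose P k := `[< exists2 G : {fset 'X_{1..n}},
  #|` G|%fset = k & monomial_span S = monomial_span [set` G]%classic >].
have exP : exists k, P k.
  by exists #|` seq_fset tt s|%fset; apply/asboolP; exists (seq_fset tt s).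
case: (ex_minnP exP) => k /asboolP[G <- eqG] Gmin; exists G; split=> // G' sG'G eqG'.
by apply/eqP; rewrite eqEfcard sG'G Gmin //; apply/asboolP; exists G'.
Qed.

Lemma mingensP I : monomial_ideal I -> is_mingens I (mingens I).
Proof. by move/is_mingens_ex; apply: xgetPex. Qed.

Lemma is_mingens_antichain I G (m m' : 'X_{1..n}) : is_mingens I G ->
  m \in G -> m' \in G -> (m' <= m)%MM -> m' = m.
Proof.
move=> [eqI Gmin] Gm Gm' le_m'm; apply/eqP; apply: contraT => ne_m'm.
have/(congr1 (fun A : {fset _} => m \in A)) : (G `\ m)%fset = G.
  apply: Gmin; first exact: fsubD1set.
  rewrite eqI; apply/seteqP; split; apply: monomial_spanS => m1 /=; last first.
    by rewrite in_fsetD1 => /andP[_ Gm1]; exists m1 => //; apply: lepm_refl.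
  move=> Gm1; have [->|ne_m1m] := eqVneq m1 m.
    by exists m' => //=; rewrite in_fsetD1 ne_m'm.
  by exists m1; [rewrite /= in_fsetD1 ne_m1m|apply: lepm_refl].
by rewrite in_fsetD1 eqxx Gm.
Qed.

Lemma is_mingens_sub I G G' : is_mingens I G -> is_mingens I G' -> (G `<=` G')%fset.
Proof.
move=> IG IG'; apply/fsubsetP => m Gm.
have : monomial_span [set` G']%classic 'X_[m].
  by rewrite -(proj1 IG') (proj1 IG); apply/monomial_spanX; exists m; rewrite ?lepm_refl.
move=> /monomial_spanX[m' /= G'm' le_m'm].
have : monomial_span [set` G]%classic 'X_[m'].
  by rewrite -(proj1 IG) (proj1 IG'); apply/monomial_spanX; exists m'; rewrite ?lepm_refl.
move=> /monomial_spanX[m1 /= Gm1 le_m1m'].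
have eq_m1 := is_mingens_antichain IG Gm Gm1 (lepm_trans le_m1m' le_m'm).
suff -> : m = m' by [].
apply/mnmP => i; apply/eqP; rewrite eqn_leq (mnm_lepP le_m'm) andbT -eq_m1.
exact: (mnm_lepP le_m1m').
Qed.

Lemma mingens_uniq I G : is_mingens I G -> mingens I = G.
Proof.
move=> IG; apply: xget_unique => // G' IG'.
by apply/eqP; rewrite eqEfsubset !(is_mingens_sub (I := I)).
Qed.

End MonomialIdeals.

Definition total_order (T : Type) (r : rel T) : Prop :=
  [/\ reflexive r, antisymmetric r, transitive r & total r].

Lemma total_order_ex (T : finType) : exists r : rel T, total_order r.
Proof.
exists (fun x y => enum_rank x <= enum_rank y)%N; split=> [x|x y|y x z|x y] //=.
- by rewrite -eqn_leq => /eqP/val_inj/enum_rank_inj.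
- exact: leq_trans.
- exact: leq_total.
Qed.

Lemma mlcmA (n : nat) : associative (@mlcm n).
Proof. by move=> a b c; apply/mnmP => i; rewrite !mnmE maxnA. Qed.

HB.instance Definition _ (n : nat) :=
  Monoid.isComLaw.Build 'X_{1..n} 0%MM (@mlcm n)
    (@mlcmA n) (@mlcmC n) (@mlc0m n).

Section PreservedSize.
Context {n : nat} {G : {fset 'X_{1..n}}} (r : rel G).
Implicit Types (D E : {set G}) (u m : G).

Definition slt u m : bool := r u m && (u != m).

Definition lcm_set D : 'X_{1..n} := \big[@mlcm n/0%MM]_(m in D) val m.

Definition is_min D m : bool := (m \in D) && [forall m' in D, r m m'].

(* Only a nonempty set has a least element, so broken sets are nonempty. *)
Definition broken D : bool :=
  [exists m, is_min D m && [exists u, (val u <= lcm_set D)%MM && slt u m]].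

Definition preserved E : bool := [forall D : {set G}, (D \subset E) ==> ~~ broken D].

Definition preserved_size : nat := (\max_(E : {set G} | preserved E) #|E|)%N.

End PreservedSize.

Record chain_complex (A : pzRingType) := ChainComplex {
  term : nat -> lmodType A;
  boundary : forall t, {linear term t.+1 -> term t};
  boundaryK : forall t (x : term t.+2), boundary t (boundary t.+1 x) = 0 }.

Definition complex_length (A : pzRingType) (C : chain_complex A) : nat :=
  greatest [set t | exists v : term C t, v != 0]%classic.

Section Lyubeznik.
Context (K : fieldType) {n : nat} {G : {fset 'X_{1..n}}} (r : rel G).
Local Notation R := {mpoly K[n]}.

(* The elements of G in increasing order, indexed from 0: [gen i] is the
   monomial written m_(i+1) on paper. *)
Definition gen (i : 'I_#|{: G}|) : 'X_{1..n} :=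
  val (nth (enum_default i) (sort r (enum {: G})) i).

(* A symbol u(i_1; ...; i_t) is the tuple of its indices. *)
Definition symbol (t : nat) := t.-tuple 'I_#|{: G}|.

Definition lcm_from (t : nat) (s : symbol t) (h : nat) : 'X_{1..n} :=
  \big[@mlcm n/0%MM]_(l < t | (h <= l)%N) gen (tnth s l).

Definition lcm_symbol (t : nat) (s : symbol t) : 'X_{1..n} := lcm_from s 0.

Definition increasing (t : nat) (s : symbol t) : bool :=
  [forall h : 'I_t, forall l : 'I_t, (h < l)%N ==> (tnth s h < tnth s l)%N].

Definition L_admissible (t : nat) (s : symbol t) : bool :=
  increasing s &&
  [forall h : 'I_t, (h.+1 < t)%N ==>
    [forall q : 'I_#|{: G}|, (q < tnth s h)%N ==> ~~ (gen q <= lcm_from s h)%MM]].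

Definition L_symbol (t : nat) := {s : symbol t | L_admissible s}.

(* The free module on the admissible symbols of dimension t. The empty symbol
   is the only one of dimension 0, so [L_term 0] is R. *)
Definition L_term (t : nat) : lmodType R := {ffun L_symbol t -> R^o}.

(* For an admissible s, the basis vector of s. *)
Definition L_basis (t : nat) (s : symbol t) : L_term t :=
  [ffun u : L_symbol t => (val u == s)%:R].

Definition face (t : nat) (s : symbol t.+1) (j : 'I_t.+1) : symbol t :=
  [tuple tnth s (lift j i) | i < t].

(* Indices j start at 0, whence the sign (-1)^j. The difference of exponents
   is the quotient of the two lcms. *)
Definition L_bd_symbol (t : nat) (s : symbol t.+1) : L_term t :=
  \sum_(j < t.+1)
    ((-1) ^+ j * 'X_[lcm_symbol s - lcm_symbol (face s j)]) *: L_basis (face s j).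

Definition L_bd (t : nat) (f : L_term t.+1) : L_term t :=
  \sum_(u : L_symbol t.+1) (f u : R) *: L_bd_symbol (val u).

Lemma L_bd_is_linear (t : nat) : linear (@L_bd t).
Proof.
move=> a f g; rewrite /L_bd scaler_sumr -big_split /=; apply: eq_bigr => u _.
by rewrite !ffunE scalerDl scalerA.
Qed.

HB.instance Definition _ (t : nat) :=
  GRing.isLinear.Build R (L_term t.+1) (L_term t) *:%R (@L_bd t) (@L_bd_is_linear t).

Lemma lcm_fromP (t : nat) (s : symbol t) (h : nat) (m : 'X_{1..n}) :
  reflect (forall l : 'I_t, (h <= l)%N -> (gen (tnth s l) <= m)%MM) (lcm_from s h <= m)%MM.
Proof.
rewrite /lcm_from; apply: (iffP idP) => [le_m l le_hl|le_m].
  by move: le_m; rewrite (bigD1 l) //= lem_mlcm => /andP[].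
elim/big_ind: _ => [|a b|l]; [|by rewrite lem_mlcm => -> ->|exact: le_m].
by apply/mnm_lepP => i; rewrite mnm0E.
Qed.

Lemma ltn_lift (t : nat) (j : 'I_t.+1) (h l : 'I_t) :
  (h < l)%N -> (lift j h < lift j l)%N.
Proof. by rewrite /= /bump; case: leqP; case: leqP => *; lia. Qed.

Lemma lcm_face_le (t : nat) (s : symbol t.+1) (j : 'I_t.+1) (h : 'I_t) :
  (lcm_from (face s j) h <= lcm_from s (lift j h))%MM.
Proof.
apply/lcm_fromP => l le_hl; rewrite tnth_mktuple.
move: (lcm_fromP s (lift j h) _ (lepm_refl _)); apply.
by rewrite /= /bump leq_add // ; case: leqP => //; case: leqP => //= *; lia.
Qed.

Lemma lcm_symbol_face (t : nat) (s : symbol t.+1) (j : 'I_t.+1) :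
  (lcm_symbol (face s j) <= lcm_symbol s)%MM.
Proof.
apply/lcm_fromP => l _; rewrite tnth_mktuple.
by move: (lcm_fromP s 0 _ (lepm_refl _)); apply.
Qed.

Lemma face_admissible (t : nat) (s : symbol t.+1) (j : 'I_t.+1) :
  L_admissible s -> L_admissible (face s j).
Proof.
move=> /andP[/forallP inc_s /forallP adm_s]; apply/andP; split.
  apply/forallP => h; apply/forallP => l; apply/implyP => lt_hl.
  rewrite !tnth_mktuple; have /forallP/(_ (lift j l))/implyP := inc_s (lift j h).
  by apply; apply: ltn_lift.
apply/forallP => h; apply/implyP => lt_ht; apply/forallP => q; apply/implyP.
rewrite tnth_mktuple => lt_q; have /implyP := adm_s (lift j h).
have -> : ((lift j h).+1 < t.+1)%N by rewrite /= /bump; case: leqP => *; lia.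
move=> /(_ isT)/forallP/(_ q)/implyP/(_ lt_q); apply: contra => le_q.
exact: lepm_trans le_q (lcm_face_le _ _ _).
Qed.

Lemma L_bd_basis (t : nat) (s : symbol t.+1) :
  L_admissible s -> L_bd (L_basis s) = L_bd_symbol s.
Proof.
move=> adm_s; rewrite /L_bd (bigD1 (exist _ s adm_s)) //= ffunE eqxx scale1r.
rewrite big1 ?addr0 // => u ne_us; rewrite ffunE.
rewrite (_ : (val u == s) = false) ?scale0r //.
by apply: contraNF ne_us => /eqP eq_us; apply/eqP/val_inj.
Qed.

Lemma face_face (t : nat) (s : symbol t.+2) (j j' : 'I_t.+2) (i i' : 'I_t.+1) :
  lift j i = j' -> lift j' i' = j -> face (face s j) i = face (face s j') i'.
Proof.
move=> eqj' eqj; apply: eq_from_tnth => l; rewrite !tnth_mktuple; congr (tnth s _).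
apply: val_inj; move: (congr1 val eqj') (congr1 val eqj) => /=.
by rewrite /bump; do 6?case: leqP => *; lia.
Qed.

Lemma alternating_face_sum (t : nat) (V : lmodType R) (s : symbol t.+2)
    (F : symbol t -> V) :
  \sum_(j < t.+2) \sum_(i < t.+1) (-1 : R) ^+ (j + i) *: F (face (face s j) i) = 0.
Proof.
rewrite pair_big /= (bigID (fun p : 'I_t.+2 * 'I_t.+1 => p.2 < p.1)%N) /=.
pose swap (p : 'I_t.+2 * 'I_t.+1) :=
  (lift p.1 p.2, odflt p.2 (unlift (lift p.1 p.2) p.1)).
have swapP p : lift (swap p).1 (swap p).2 = p.1.
  rewrite /swap /=; case: unliftP => [i /esym //|/eqP].
  by rewrite (negPf (neq_lift _ _)).
have swap2 p : (val (swap p).1 = bump p.1 p.2) /\ bump (swap p).1 (swap p).2 = p.1.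
  by split=> //; rewrite -[in RHS](swapP p).
have swapK : involutive swap.
  move=> p; apply: injective_projections; rewrite {1}/swap /=; first exact: swapP.
  apply: val_inj => /=; have [] := swap2 (swap p); have [] := swap2 p.
  by rewrite /swap /= /bump; do 8?case: leqP => *; lia.
clearbody swap; rewrite [X in _ + X](reindex_inj (inv_inj swapK)) /=.
rewrite [X in _ + X](eq_bigl (fun p : 'I_t.+2 * 'I_t.+1 => p.2 < p.1)%N) => [|p]; last first.
  have [] := swap2 p; move: (swap p) => [j' i'] /= ->.
  by rewrite /bump; do 6?case: leqP => *; lia.
rewrite -big_split big1 //= => p lt_p.
have sw1 : lift p.1 p.2 = (swap p).1 by apply: val_inj; case: (swap2 p).
rewrite -(face_face s sw1 (swapP p)).
rewrite -scalerDl; suff -> : (p.1 + p.2 = ((swap p).1 + (swap p).2).+1)%N.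
  by rewrite exprS mulN1r addNr scale0r.
have [] := swap2 p; move: (swap p) => [j' i'] /= ->.
by move: lt_p; rewrite /bump; do 6?case: leqP => *; lia.
Qed.

Lemma L_bdK (t : nat) (x : L_term t.+2) : L_bd (L_bd x) = 0.
Proof.
suff bd0 (s : symbol t.+2) : L_admissible s -> L_bd (L_bd_symbol s) = 0.
  by rewrite {2}/L_bd linear_sum big1 // => u _; rewrite linearZ /= bd0 ?scaler0 ?(valP u).
move=> adm_s; rewrite /L_bd_symbol linear_sum -[RHS](alternating_face_sum s
  (fun s' => 'X_[lcm_symbol s - lcm_symbol s'] *: L_basis s')).
apply: eq_bigr => j _; rewrite linearZ /= L_bd_basis; last exact: face_admissible.
rewrite /L_bd_symbol scaler_sumr; apply: eq_bigr => i _.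
rewrite !scalerA exprD -!mulrA; congr (_ * _ *: _).
rewrite mulrCA; congr (_ * _); rewrite -mpolyXD; congr 'X_[_].
have le1 := mnm_lepP (lcm_symbol_face s j).
have le2 := mnm_lepP (lcm_symbol_face (face s j) i).
by apply/mnmP => k; rewrite mnmDE !mnmBE; move: (le1 k) (le2 k); lia.
Qed.

Definition lyubeznik_resolution : chain_complex R := ChainComplex L_bdK.

Lemma lyubeznik_resolution0 : exists v : term lyubeznik_resolution 0, v != 0.
Proof.
have adm : L_admissible ([tuple] : symbol 0).
  by apply/andP; split; apply/forallP => -[].
exists (L_basis [tuple]); apply/eqP => /ffunP/(_ (exist _ [tuple] adm)).
by rewrite !ffunE eqxx; apply/eqP/oner_neq0.
Qed.

Lemma lyubeznik_resolution_bounded (t : nat) :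
  (exists v : term lyubeznik_resolution t, v != 0) -> (t <= #|{: G}|)%N.
Proof.
move=> [v nz_v].
have [s /andP[/forallP inc_s _]|noS] := pickP (fun s : symbol t => L_admissible s).
  suff inj_s : injective (tnth s) by have := leq_card _ inj_s; rewrite !card_ord.
  move=> h l eq_hl; apply: val_inj; case: (ltngtP h l) => // [lt_hl|lt_lh].
    by have /forallP/(_ l) := inc_s h; rewrite lt_hl eq_hl ltnn.
  by have /forallP/(_ h) := inc_s l; rewrite lt_lh eq_hl ltnn.
by case/eqP: nz_v; apply/ffunP => -[s adm_s]; have := noS s; rewrite /= adm_s.
Qed.

End Lyubeznik.

Section Invariants.
Context {K : fieldType} {n : nat} (I : set {mpoly K[n]}).

Definition lyubeznik_length_ord (r : rel (mingens I)) : nat :=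
  complex_length (lyubeznik_resolution K r).

Definition lyubeznik_length : nat :=
  least [set lyubeznik_length_ord r | r in [set r | total_order r]]%classic.

Definition ps_ord (r : rel (mingens I)) : nat := preserved_size r.

Definition ps : nat :=
  least [set ps_ord r | r in [set r | total_order r]]%classic.

End Invariants.

(* Main.v *)
Require Import Defs.
From mathcomp Require Import all_boot all_order all_algebra finmap.
From mathcomp Require Import classical_sets mpoly.

(** Both invariants measure the same family of subsets of G(I).  Listing the
    elements of a set E increasingly turns E into a symbol, and the symbol is
    L-admissible exactly when E is preserved ([L_admissible_preserved]).

    Admissibility forbids certain generators from dividing the lcms of the
    tails (m_(i_h), ..., m_(i_t)), that is, it says that the tails of E are not
    broken.  Testing tails suffices: a subset D of E with least element m_(i_h)
    lies in the tail starting at i_h, which has the same least element and a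
    larger lcm, so it is broken as soon as D is.  The one tail on which
    admissibility is silent is the singleton (m_(i_t)), and it is never broken
    because no minimal generator divides another one.

    As L^t is free on the admissible symbols of dimension t, the length of the
    resolution is the largest dimension of such a symbol ([L_term_neq0P]), hence
    the largest size of a preserved set.  Equality for every order gives
    equality of the two minima. *)

Set Implicit Arguments.
Unset Strict Implicit.
Unset Printing Implicit Defensive.

Import GRing.Theory.

Section PreservedSymbols.
Context {n : nat} {G : {fset 'X_{1..n}}} (r : rel G).
Hypothesis r_total : total_order r.
Local Notation N := #|{: G}|.

Definition nth_gen (i : 'I_N) : G :=
  nth (enum_default i) (sort r (enum {: G})) i.

Lemma size_sort_enum : size (sort r (enum {: G})) = N.
Proof. by rewrite size_sort -cardE. Qed.

Lemma nth_gen_inj : injective nth_gen.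
Proof.
(* The default value of nth depends on the index, so it is made uniform first. *)
move=> i j; rewrite /nth_gen (set_nth_default (enum_default i)) ?size_sort_enum //.
move=> eq_ij; apply/val_inj/eqP; rewrite /= eq_sym.
by rewrite -(nth_uniq (enum_default i) _ _ (s := sort r (enum {: G})))
  ?size_sort_enum ?sort_uniq ?enum_uniq // eq_ij
  (set_nth_default (enum_default j)) ?size_sort_enum.
Qed.

Lemma nth_gen_surj (x : G) : exists i, nth_gen i = x.
Proof.
have [f _ fK] := inj_card_bij nth_gen_inj (eq_leq (esym (card_ord _))).
by exists (f x).
Qed.

Lemma r_nth_gen (i j : 'I_N) : r (nth_gen i) (nth_gen j) = (i <= j)%N.
Proof.
have [r_refl r_anti r_trans r_tot] := r_total.
have le_r (k l : 'I_N) : (k <= l)%N -> r (nth_gen k) (nth_gen l).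
  rewrite /nth_gen [in X in r _ X](set_nth_default (enum_default k)) ?size_sort_enum //.
  by apply: sorted_leq_nth => //; rewrite ?inE ?size_sort_enum // sort_sorted.
apply/idP/idP => [r_ij|/le_r //]; rewrite leqNgt; apply/negP => lt_ji.
have /nth_gen_inj eq_ij : nth_gen i = nth_gen j.
  by apply: r_anti; rewrite r_ij le_r // ltnW.
by rewrite eq_ij ltnn in lt_ji.
Qed.

Lemma slt_nth_gen (i j : 'I_N) : slt r (nth_gen i) (nth_gen j) = (i < j)%N.
Proof.
by rewrite /slt r_nth_gen (inj_eq nth_gen_inj) andbC ltn_neqAle.
Qed.

Lemma lcm_setP (D : {set G}) (m : 'X_{1..n}) :
  reflect (forall x, x \in D -> (val x <= m)%MM) (lcm_set D <= m)%MM.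
Proof.
rewrite /lcm_set; apply: (iffP idP) => [le_m x Dx|le_m].
  by move: le_m; rewrite (bigD1 x) //= lem_mlcm => /andP[].
elim/big_ind: _ => [|a b|x]; [|by rewrite lem_mlcm => -> ->|exact: le_m].
by apply/mnm_lepP => i; rewrite mnm0E.
Qed.

Definition symbol_set t (s : symbol (G := G) t) : {set G} :=
  [set nth_gen (tnth s l) | l : 'I_t].

Lemma increasing_leq t (s : symbol (G := G) t) (h l : 'I_t) :
  increasing s -> (tnth s h <= tnth s l)%N = (h <= l)%N.
Proof.
move=> /forallP inc_s.
have lt_s (i j : 'I_t) : (i < j)%N -> (tnth s i < tnth s j)%N.
  by have /forallP/(_ j)/implyP := inc_s i.
case: (ltngtP h l) => [/lt_s/ltnW //|/lt_s|/val_inj->]; last exact: leqnn.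
by rewrite ltnNge => /negbTE.
Qed.

Lemma card_symbol_set t (s : symbol (G := G) t) :
  increasing s -> #|symbol_set s| = t.
Proof.
move=> inc_s; rewrite card_imset ?card_ord // => h l /nth_gen_inj eq_hl.
by apply/val_inj/eqP; rewrite eqn_leq -!(increasing_leq _ _ inc_s) eq_hl leqnn.
Qed.

(** The enumeration of a set of ordinals is increasing, so the indices of the
    elements of E, as enumerated, already form the symbol. *)
Lemma symbol_of_set (E : {set G}) :
  exists2 s : symbol (G := G) #|E|, increasing s & symbol_set s = E.
Proof.
have imE : nth_gen @: (nth_gen @^-1: E) = E.
  apply/setP => x; apply/imsetP/idP => [[i /[!inE] Ei -> //]|Ex].
  by have [i eq_x] := nth_gen_surj x; exists i; rewrite ?inE eq_x.
pose A := nth_gen @^-1: E; rewrite -imE -/A card_imset; last exact: nth_gen_inj.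
exists (enum_tuple A).
  have ltA : sorted (relpre val ltn) (enum A).
    rewrite {1}/enum_mem -enumT; apply: sorted_filter; first by move=> ? ? ?; apply: ltn_trans.
    by rewrite -sorted_map val_enum_ord iota_ltn_sorted.
  apply/forallP => h; apply/forallP => l; apply/implyP => lt_hl.
  have x0 := tnth (enum_tuple A) h; rewrite !(tnth_nth x0).
  apply: (sorted_ltn_nth _ _ ltA) => //; rewrite ?inE -?cardE //.
  by move=> ? ? ?; apply: ltn_trans.
apply/setP => x; apply/imsetP/imsetP => [[l _ ->]|[i Ai ->]].
  by exists (tnth (enum_tuple A) l) => //; rewrite -mem_enum mem_tnth.
have /tnthP[l ->] : i \in enum_tuple A by rewrite mem_enum.
by exists l.
Qed.

(** The antichain hypothesis stands for minimality of the generators: it is what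
    keeps the singleton tail of a symbol from being broken. *)
Lemma L_admissible_preserved t (s : symbol (G := G) t) :
    (forall m m' : 'X_{1..n}, m \in G -> m' \in G -> (m' <= m)%MM -> m' = m) ->
    increasing s ->
  L_admissible r s = preserved r (symbol_set s).
Proof.
move=> antiG inc_s; rewrite /L_admissible inc_s /=.
apply/forallP/forallP => [adm_s D|pres_s h].
  apply/implyP => /fintype.subsetP sDs; apply/existsP => -[m /andP[/andP[Dm min_m]]].
  move=> /existsP[u /andP[le_u lt_um]].
  have /imsetP[h _ eq_m] := sDs _ Dm; have [q eq_u] := nth_gen_surj u.
  move: lt_um; rewrite -eq_u eq_m slt_nth_gen => lt_qh.
  have le_q : (gen r q <= lcm_from r s h)%MM.
    rewrite /gen -/(nth_gen q) eq_u; apply: lepm_trans le_u _.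
    apply/lcm_setP => x Dx; have /imsetP[l _ eq_x] := sDs _ Dx.
    have /implyP/(_ Dx) := forallP min_m x.
    rewrite eq_m eq_x r_nth_gen (increasing_leq _ _ inc_s) => le_hl.
    exact: (lcm_fromP r s h _ (lepm_refl _)).
  have [lt_ht|le_th] := ltnP h.+1 t.
    by have /implyP/(_ lt_ht)/forallP/(_ q)/implyP/(_ lt_qh)/negP := adm_s h.
  (* The tail at h is the singleton of the last entry of s. *)
  have le_qh : (val (nth_gen q) <= val (nth_gen (tnth s h)))%MM.
    apply: lepm_trans le_q _; apply/lcm_fromP => l le_hl.
    suff -> : l = h by exact: lepm_refl.
    apply/val_inj/eqP; rewrite eqn_leq le_hl andbT.
    by rewrite -ltnS (leq_trans (ltn_ord l)).
  have /val_inj/nth_gen_inj eq_qh := antiG _ _ (valP _) (valP _) le_qh.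
  by rewrite eq_qh ltnn in lt_qh.
apply/implyP => _; apply/forallP => q; apply/implyP => lt_qh; apply/negP => le_q.
(* The tail of s at h: its least element is its first one, and nth_gen q breaks it. *)
pose D := [set nth_gen (tnth s l) | l in [pred l : 'I_t | (h <= l)%N]].
have /implyP/(_ _)/negP := pres_s D; apply.
  by apply/fintype.subsetP => x /imsetP[l _ ->]; apply: imset_f.
apply/existsP; exists (nth_gen (tnth s h)); apply/andP; split.
  apply/andP; split; first by apply: imset_f; rewrite inE /=.
  apply/forallP => x; apply/implyP.
  by move=> /imsetP[l]; rewrite inE => le_hl ->; rewrite r_nth_gen increasing_leq.
apply/existsP; exists (nth_gen q); rewrite slt_nth_gen lt_qh andbT.
apply: lepm_trans le_q _; apply/lcm_fromP => l le_hl.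
by apply: (lcm_setP D _ (lepm_refl _)); apply: imset_f.
Qed.

End PreservedSymbols.

Lemma L_term_neq0P (K : fieldType) n (G : {fset 'X_{1..n}}) (r : rel G) t :
  (exists v : term (lyubeznik_resolution K r) t, v != 0%R) <->
  exists s : symbol t, L_admissible r s.
Proof.
split=> [[v nz_v]|[s adm_s]].
  have [s adm_s|noS] := pickP (fun s : symbol t => L_admissible r s); first by exists s.
  by case/eqP: nz_v; apply/ffunP => -[s adm_s]; have := noS s; rewrite /= adm_s.
exists (L_basis K r s); apply/eqP => /ffunP/(_ (exist _ s adm_s)).
by rewrite !ffunE eqxx; apply/eqP/oner_neq0.
Qed.

Lemma lyubeznik_length_preserved_size (K : fieldType) n (G : {fset 'X_{1..n}})
    (r : rel G) :
    total_order r ->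
    (forall m m' : 'X_{1..n}, m \in G -> m' \in G -> (m' <= m)%MM -> m' = m) ->
  complex_length (lyubeznik_resolution K r) = preserved_size r.
Proof.
move=> r_total antiG.
have [/L_term_neq0P[s adm_s] len_max] := greatestP
  (ex_intro _ 0%N (lyubeznik_resolution0 K r)) (@lyubeznik_resolution_bounded K _ _ r).
rewrite /complex_length; apply/eqP; rewrite eqn_leq; apply/andP; split.
  have /andP[inc_s _] := adm_s.
  rewrite -[leqLHS](card_symbol_set r inc_s).
  by apply: leq_bigmax_cond; rewrite -L_admissible_preserved.
apply/bigmax_leqP => E pres_E; have [s' inc_s' eq_E] := symbol_of_set r E.
by apply/len_max/L_term_neq0P; exists s'; rewrite L_admissible_preserved // eq_E.
Qed.

Theorem theorem5p5 (K : fieldType) (n : nat) (I : set {mpoly K[n]})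
    (hI : monomial_ideal I) :
  (forall r : rel (mingens I), total_order r ->
     lyubeznik_length_ord r = ps_ord r) /\
  lyubeznik_length I = ps I.
Proof.
have eq_ord (r : rel (mingens I)) : total_order r -> lyubeznik_length_ord r = ps_ord r.
  move=> r_total; apply: lyubeznik_length_preserved_size => // m m'.
  exact: is_mingens_antichain (mingensP hI).
split=> //; congr least; apply/seteqP.
by split=> _ [r r_total <-]; exists r => //; rewrite eq_ord.
Qed.
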